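(* Let $\mathbb{F}$ be a field, let $s,t\in\mathbb{N}$ with $s,t\ge 2$, and let $n\ge s\cdot t^4$ be an integer. Let $U$ be an $n$-dimensional vector space over $\mathbb{F}$. Then for any linear subspace $\mathcal{A}\le\Lambda(U)$, either there exists a subspace $V\le U$ with $\dim(V)=s$ such that $\mathcal{A}|_V$ is the zero space, or there exists a subspace $W\le U$ with $\dim(W)=t$ such that $\mathcal{A}|_W=\Lambda(W)$.
   Context: For a vector space $U$ over a field $\mathbb{F}$, a bilinear form $f:U\times U\to\mathbb{F}$ is alternating if $f(u,u)=0$ for all $u\in U$. $\Lambda(U)$ denotes the $\mathbb{F}$-linear space of all alternating bilinear forms on $U$. The notation $W\le U$ means that $W$ is a linear subspace of $U$. For $W\le U$, $f|_W:W\times W\to\mathbb{F}$ is the restriction of $f$ to $W$, and for $\mathcal{A}\le\Lambda(U)$, $\mathcal{A}|_W:=\{f|_W\mid f\in\mathcal{A}\}\le\Lambda(W)$. *)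

(* Defs.v *)
From HB Require Import structures.
From mathcomp Require Import all_boot all_order all_algebra.

Set Implicit Arguments.
Unset Strict Implicit.
Unset Printing Implicit Defensive.

Import GRing.Theory.
Local Open Scope ring_scope.

(* Bilinear forms on U in curried form: f u v is the value at (u, v). They
   form a vectType, and by biscalar_bilform every bilinear map U -> U -> F
   is of this kind. *)

Section BilinearForms.
Variables (F : fieldType) (U : vectType F).
Implicit Types (f : 'Hom(U, 'Hom(U, F^o))) (W : {vspace U}).

Lemma biscalar_bilform (b : {biscalar U}) :
  exists f, forall u v, f u v = b u v.
Proof.
pose f1 u : 'Hom(U, F^o) := linfun (b u : U -> F^o).
have f1E u v : f1 u v = b u v.
  have lin_b : linear (b u : U -> F^o) by move=> a x y; rewrite linearPr.
  pose bL := GRing.isLinear.Build _ _ _ _ (b u : U -> F^o) lin_b.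
  pose g : {linear U -> F^o} := HB.pack (b u : U -> F^o) bL.
  exact: (lfunE g).
have lin_f1 : linear f1.
  move=> a x y; apply/lfunP=> v.
  by rewrite add_lfunE scale_lfunE !f1E linearPl.
pose f1L := GRing.isLinear.Build _ _ _ _ f1 lin_f1.
pose g : {linear U -> 'Hom(U, F^o)} := HB.pack f1 f1L.
exists (linfun g) => u v.
by rewrite lfunE f1E.
Qed.

Definition alternating f : Prop := forall u : U, f u u = 0.

Definition restr_fun W f : 'Hom(subvs_of W, 'Hom(subvs_of W, F^o)) :=
  linfun (fun w : subvs_of W => (f (vsval w) \o linfun vsval)%VF).

(* f |-> f|_W as a linear map; the space A|_W is (restr W @: A)%VS. *)
Definition restr W := linfun (restr_fun W).

Lemma restr_funE W f (w w' : subvs_of W) :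
  restr_fun W f w w' = f (vsval w) (vsval w').
Proof.
pose h (w : subvs_of W) : 'Hom(subvs_of W, F^o) :=
  (f (vsval w) \o linfun vsval)%VF.
have lin_h : linear h.
  move=> a x y; apply/lfunP=> v.
  by rewrite add_lfunE scale_lfunE !comp_lfunE linearP add_lfunE scale_lfunE.
pose hL := GRing.isLinear.Build _ _ _ _ h lin_h.
pose g : {linear subvs_of W -> 'Hom(subvs_of W, F^o)} := HB.pack h hL.
by rewrite /restr_fun (lfunE g) /= /h comp_lfunE lfunE.
Qed.

Lemma restrE W f (w w' : subvs_of W) :
  restr W f w w' = f (vsval w) (vsval w').
Proof.
have lin_r : linear (restr_fun W).
  move=> a x y; apply/lfunP=> v; apply/lfunP=> v'.
  by rewrite !(add_lfunE, scale_lfunE, restr_funE).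
pose rL := GRing.isLinear.Build _ _ _ _ (restr_fun W) lin_r.
pose g : {linear 'Hom(U, 'Hom(U, F^o)) ->
  'Hom(subvs_of W, 'Hom(subvs_of W, F^o))} := HB.pack (restr_fun W) rL.
by rewrite /restr (lfunE g) /= restr_funE.
Qed.

End BilinearForms.

(* Main.v *)
(* Put B := A^* and view A as one alternating map phi : U x U -> B; functionals
   on B are exactly the forms in A.  Greedily adding vectors w and passing to a
   complement of w in the kernel of phi(w, -) produces a totally isotropic space
   of dimension s, unless this stops at a subspace K on which all phi(w, -),
   w <> 0, have rank at least r := t^4.  In K one then picks w_1, ..., w_t such
   that the phi(w_i, w_j), i < j, are linearly independent, which is equivalent
   to A restricting onto all alternating forms on <w_1, ..., w_t>.  The choice
   of w_(k+1) asks for x with phi(w, x) outside S := <phi(w_i, w_j)> for every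
   nonzero w in <w_1, ..., w_k>; by an argument in the style of Amitsur's lemma
   on locally dependent operators, such an x exists over every field as soon as
   the ranks exceed dim S by a quadratic function of k. *)
Require Import Defs.
From HB Require Import structures.
From mathcomp Require Import all_boot all_order all_algebra.
From mathcomp Require Import zify.
From Stdlib Require Import Classical.

Set Implicit Arguments.
Unset Strict Implicit.
Unset Printing Implicit Defensive.

Import GRing.Theory.
Local Open Scope ring_scope.

(** * Vectors avoiding finitely many subspaces, and dimension counts *)

Section Subspaces.
Variables (F : fieldType) (U : vectType F).
Implicit Types (u v w x : U) (H K L V W : {vspace U}).

Lemma dimv_diff_line V w : w \in V -> w != 0 ->
  (\dim (V :\: <[w]>)%VS).+1 = \dim V.
Proof.
move=> Vw w0; rewrite -(dimv_cap_compl V <[w]>).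
by rewrite (capv_idPr _) ?memvE // dim_vline w0.
Qed.

(** Adding to [H] a complement of [H + <[u]>] gives a hyperplane of [U] that contains [H] but not
    [u]; [L] is its trace on [K]. *)
Lemma hyperplane_avoiding K H u : u \notin H ->
  exists2 L, [/\ (L <= K)%VS & (\dim K <= (\dim L).+1)%N]
    & forall y, y \in L -> u + y \notin H.
Proof.
move=> Hu.
have u0 : u != 0 by apply: contraNneq Hu => ->; apply: mem0v.
pose C := (H + <[u]>)%VS; pose L := (H + C^C)%VS.
have capHu : (H :&: <[u]> = 0)%VS.
  apply/eqP; rewrite -subv0; apply/subvP=> v /memv_capP[+ /vlineP[c vE]].
  by rewrite vE rpredZeq (negPf Hu) orbF => /eqP->; rewrite scale0r mem0v.
have CU : (C + C^C = fullv)%VS by apply: addv_complf.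
have dimL : (\dim {:U} <= (\dim L).+1)%N.
  have -> : fullv = (L + <[u]>)%VS.
    by rewrite -CU /L /C -!addvA [(<[u]> + _)%VS]addvC.
  apply: leq_trans (dimv_add_leqif _ _) _.
  by rewrite dim_vline u0 addn1.
have Lu : u \notin L.
  apply/memv_addP=> -[h Hh [c Cc uE]].
  have c0 : c = 0.
    apply/eqP; rewrite -memv0 -(capv_compl C) memv_cap Cc andbT.
    have -> : c = - h + u by rewrite uE addKr.
    by rewrite memv_add ?memvN ?memv_line.
  by case/negP: Hu; rewrite uE c0 addr0.
exists (K :&: L)%VS.
  split; first exact: capvSl.
  have := dimv_sum_cap K L; have := dimvS (subvf (K + L)%VS); lia.
move=> y /memv_capP[_ Ly]; apply: contra Lu => Huy.
by rewrite -(addrK y u) memvB // (subvP (addvSl _ _)).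
Qed.

(* The translate by x is what makes the induction work: it replaces K by an
   affine hyperplane disjoint from one of the subspaces. *)
Lemma avoid_subspaces_affine (Hs : seq {vspace U}) K x :
  (forall H, H \in Hs -> \dim (K :&: H) + size Hs <= \dim K)%N ->
  exists2 v, v \in K & forall H, H \in Hs -> x + v \notin H.
Proof.
elim: Hs K x => [|H Hs IH] K x codimH; first by exists 0; rewrite ?mem0v.
have [a Ka Ha] : exists2 a, a \in K & x + a \notin H.
  have [Hx|Hx] := boolP (x \in H); last by exists 0; rewrite ?mem0v ?addr0.
  have /subvPn[a Ka Ha] : ~~ (K <= H)%VS.
    apply/negP=> /capv_idPl KH.
    by have := codimH H (mem_head _ _); rewrite KH /=; lia.
  by exists a; rewrite // rpredDl.
have [L [LK dimL] LH] := hyperplane_avoiding K Ha.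
(* Passing from [K] to [L] lowers each codimension by at most one, just as the list gets shorter by
   one. *)
have [|v Lv vHs] := IH L (x + a).
  move=> H' H'Hs.
  have := codimH H'; rewrite inE H'Hs orbT => /(_ isT) /=.
  have := dimvS (capvS LK (subvv H')); lia.
exists (a + v); first by rewrite memvD // (subvP LK).
move=> H'; rewrite inE addrA => /predU1P[->|]; [exact: LH | exact: vHs].
Qed.

Lemma avoid_subspaces (Hs : seq {vspace U}) K :
  (forall H, H \in Hs -> \dim (K :&: H) + size Hs <= \dim K)%N ->
  exists2 v, v \in K & forall H, H \in Hs -> v \notin H.
Proof.
move=> codimH; have [v Kv vHs] := avoid_subspaces_affine 0 codimH.
by exists v => // H /vHs; rewrite add0r.
Qed.

Lemma dimv_capD K V W : (\dim (K :&: (V + W)) <= \dim (K :&: V) + \dim W)%N.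
Proof.
pose Y := (K :&: (V + W))%VS.
have YV : (Y :&: V = K :&: V)%VS.
  by rewrite /Y -capvA; congr (_ :&: _)%VS; apply/capv_idPr/addvSl.
have := dimv_sum_cap Y V; rewrite YV -/Y => dimY.
have : (Y + V <= V + W)%VS by rewrite subv_add capvSr addvSl.
have := (dimv_add_leqif V W).1; move=> dimVW /dimvS; lia.
Qed.

Lemma line_of_small_complement D V W a b :
  (D <= W)%VS -> (V <= W)%VS -> (D :&: V = 0)%VS ->
  (\dim W <= (\dim V).+1)%N -> a \in D -> a != 0 -> b \in D ->
  exists c, b = c *: a.
Proof.
move=> DW VW DV dimV Da a0 Db; apply/vlineP.
suff -> : <[a]>%VS = D by [].
apply/eqP; rewrite eqEdim -memvE Da /= dim_vline a0 /=.
have := dimv_disjoint_sum DV; have : (D + V <= W)%VS by rewrite subv_add DW.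
by move=> /dimvS; lia.
Qed.

End Subspaces.

(** * Preimages under a linear map *)

Section LinearMaps.
Variables (F : fieldType) (U B : vectType F).
Implicit Types (f : 'Hom(U, B)) (K : {vspace U}) (S T : {vspace B}).

(** Rank-nullity on [K :&: f @^-1: R] isolates the kernel part, which does not depend on [R]; the
    rest is a count inside [f @: K]. *)
Lemma dim_cap_preimD f K S T :
  (\dim (K :&: f @^-1: (S + T)) <= \dim (K :&: f @^-1: S) + \dim T)%N.
Proof.
have dimE R : \dim (K :&: f @^-1: R)
    = (\dim (K :&: lker f) + \dim (f @: K :&: R))%N.
  rewrite -(limg_ker_dim f (K :&: _)); congr (_ + _)%N; congr (\dim _).
    apply/vspaceP=> u; rewrite !memv_cap -memv_preim memv_ker -andbA.
    by case: eqP => [->|]; rewrite ?mem0v ?andbF.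
  apply/vspaceP=> y; apply/memv_imgP/memv_capP.
    move=> [u /memv_capP[Ku]]; rewrite -memv_preim => Ru ->.
    by rewrite memv_img.
  move=> [/memv_imgP[u Ku ->] Ry]; exists u => //.
  by rewrite memv_cap Ku -memv_preim.
by rewrite !dimE -addnA leq_add2l dimv_capD.
Qed.

End LinearMaps.

(** * Locally dependent operators, in the style of Amitsur *)

Section Amitsur.
Variables (F : fieldType) (X U B : vectType F).
Variables (M : 'Hom(X, 'Hom(U, B))) (N : 'Hom(U, 'Hom(X, B))).
Hypothesis MN : forall w v, M w v = N v w.

(** Large ranks of all [M w] modulo [S] yield one [v] for which [N v] is injective on [W] modulo
    [S]. A vector [v0] that works on a hyperplane [W'] of [W] is corrected by a second vector [v];
    the candidates are [v0], [v] and [v + v0]. The list [Hs] lets the induction impose further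
    conditions on [v]. *)
Lemma separating_vector (K : {vspace U}) k :
  forall (W : {vspace X}) (S : {vspace B}) (Hs : seq {vspace U}) r,
  \dim W = k -> (size Hs + k * k.+2 <= r)%N ->
  (forall H, H \in Hs -> \dim (K :&: H) + r <= \dim K)%N ->
  (forall w, w \in W -> w != 0 ->
     (\dim (K :&: M w @^-1: S) + r <= \dim K)%N) ->
  exists v, [/\ v \in K, forall H, H \in Hs -> v \notin H
    & forall w, w \in W -> M w v \in S -> w = 0].
Proof.
elim: k => [|k IH] W S Hs r dimW ler codimH codimM.
  have [|v Kv vHs] := @avoid_subspaces _ _ Hs K.
    by move=> H /codimH; lia.
  exists v; split=> // w + _; move/eqP: dimW; rewrite dimv_eq0 => /eqP->.
  by rewrite memv0 => /eqP.
have W0 : W != 0%VS by rewrite -dimv_eq0 dimW.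
pose W' := (W :\: <[vpick W]>)%VS.
have dimW' : \dim W' = k.
  by apply/eq_add_S; rewrite dimv_diff_line ?memv_pick ?vpick0.
have W'W : (W' <= W)%VS by apply: diffvSl.
have [||v0 [Kv0 v0Hs v0W']] := IH W' S Hs r dimW' _ codimH.
- by nia.
- by move=> w /(subvP W'W); apply: codimM.
pose Z v T := (W :&: N v @^-1: T)%VS.
have memZ v T w : (w \in Z v T) = (w \in W) && (M w v \in T).
  by rewrite memv_cap -memv_preim MN.
have [Z0|Z_neq0] := eqVneq (Z v0 S) 0%VS.
  exists v0; split=> // w Ww Sw; apply/eqP.
  by rewrite -memv0 -Z0 memZ Ww Sw.
pose w1 := vpick (Z v0 S).
have w1_neq0 : w1 != 0 by rewrite vpick0.
have Zw1 : w1 \in Z v0 S by apply: memv_pick.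
have Ww1 : w1 \in W by move: Zw1; rewrite memZ => /andP[].
(* Modulo [S'], the maps [N v] and [N (v + v0)] agree on [W]. *)
pose S' := (S + N v0 @: W)%VS.
(* The first entry forces [M w1 v] out of [S]; the widened ones keep both [v] and [v + v0] out of
   each [H]. *)
pose Hs' := (M w1 @^-1: S)%VS :: [seq (H + <[v0]>)%VS | H <- Hs].
have lineW (T : {vspace B}) v a b : (forall w, w \in W' -> M w v \in T -> w = 0) ->
    a \in Z v T -> a != 0 -> b \in Z v T -> exists c, b = c *: a.
  move=> vW'; apply: line_of_small_complement (capvSl _ _) W'W _ _.
    apply/eqP; rewrite -subv0; apply/subvP=> w /memv_capP[].
    by rewrite memZ => /andP[_ Tw] /vW' /(_ Tw) ->; apply: mem0v.
  by rewrite dimW dimW'.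
(* Enlarging [S] to [S'] costs at most [\dim W = k.+1] in codimension, and widening [H] by a line
   costs at most one. *)
have [|||v [Kv vHs vW']] := IH W' S' Hs' (r - k.+1)%N dimW'.
- by rewrite /= size_map; nia.
- move=> H'; rewrite inE => /predU1P[->|/mapP[H HHs ->]].
    by have := codimM _ Ww1 w1_neq0; lia.
  have := codimH H HHs; have := dimv_capD K H <[v0]>.
  by rewrite dim_vline; case: (v0 != 0) => /=; lia.
- move=> w /(subvP W'W) Ww w0; have := codimM _ Ww w0.
  have := dim_cap_preimD (M w) K S (N v0 @: W); rewrite -/S'.
  have := limg_ker_dim (N v0) W; rewrite dimW; lia.
have vw1 : M w1 v \notin S.
  by have := vHs _ (mem_head _ _); rewrite -memv_preim.
have vH H : H \in Hs -> v \notin (H + <[v0]>)%VS.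
  move=> HHs; apply: vHs; rewrite inE; apply/orP; right.
  exact: (map_f (fun H => H + <[v0]>)%VS).
have SS' y : y \in S -> y \in S' by apply: (subvP (addvSl _ _)).
have [Z0|Zv] := eqVneq (Z v S) 0%VS.
  exists v; split=> // [H /vH|w Ww Sw].
    by apply: contra; apply: (subvP (addvSl _ _)).
  by apply/eqP; rewrite -memv0 -Z0 memZ Ww Sw.
exists (v + v0); split; first by rewrite memvD.
  move=> H /vH; apply: contra => Hv; rewrite -(addrK v0 v).
  by rewrite memv_add // memvN memv_line.
(* Modulo S', N v has a kernel of dimension at most one on W.  A common kernel
   vector b of N v and N (v + v0) modulo S lies in the kernel of N v0, that is
   on the line of w1, which N v does not kill. *)
move=> b Wb Sb; have [//|b0] := eqVneq b 0.
have a0 : vpick (Z v S) != 0 by rewrite vpick0.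
have := memv_pick (Z v S); set a := vpick _ in a0 * => Za.
have S'b : M b v \in S'.
  have -> : M b v = M b (v + v0) + N v0 (- b).
    by rewrite linearD linearN /= -MN addrK.
  by rewrite memv_add // memv_img ?memvN.
have [c bE] : exists c, b = c *: a.
  apply: (lineW S' v); rewrite // memZ ?Wb //.
  by move: Za; rewrite memZ => /andP[-> /SS' ->].
have Sbv : M b v \in S.
  have : b \in Z v S by rewrite bE memvZ.
  by rewrite memZ => /andP[].
have Zb : b \in Z v0 S.
  rewrite memZ Wb /=; have -> : M b v0 = M b (v + v0) - M b v.
    by rewrite linearD /= addrC addKr.
  by rewrite memvB.
have [d bE'] := lineW S v0 _ _ v0W' Zw1 w1_neq0 Zb.
have d0 : d != 0 by apply: contraNneq b0 => d0; rewrite bE' d0 scale0r.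
by move: Sbv; rewrite bE' linearZ scale_lfunE rpredZeq (negPf d0) (negPf vw1).
Qed.

End Amitsur.

(* After rewriting with linearD, the sum in Hom(U, B) comes with an instance
   path on which rewriting with add_lfunE fails. *)
Section BilinearMaps.
Variables (F : fieldType) (X U B : vectType F) (M : 'Hom(X, 'Hom(U, B))).

Lemma bilinearDl u v w : M (u + v) w = M u w + M v w.
Proof. have -> : M (u + v) = M u + M v by exact: linearD. exact: add_lfunE. Qed.

Lemma bilinearZl a u w : M (a *: u) w = a *: M u w.
Proof. have -> : M (a *: u) = a *: M u by exact: linearZ. exact: scale_lfunE. Qed.

End BilinearMaps.

(** One value per unordered pair of positions: for an alternating map the diagonal vanishes and
    swapping only changes the sign. *)
Fixpoint pairwise_values T1 T2 (h : T1 -> T1 -> T2) (ws : seq T1) : seq T2 :=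
  if ws is x :: ws' then [seq h w x | w <- ws'] ++ pairwise_values h ws'
  else [::].

Lemma map_pairwise_values T1 T2 T3 (g : T2 -> T3) (h : T1 -> T1 -> T2) ws :
  [seq g y | y <- pairwise_values h ws]
    = pairwise_values (fun u v => g (h u v)) ws.
Proof. by elim: ws => //= x ws IH; rewrite map_cat IH -map_comp. Qed.

Lemma size_pairwise_values T1 T2 (h : T1 -> T1 -> T2) ws :
  size (pairwise_values h ws) = 'C(size ws, 2).
Proof.
by elim: ws => //= x ws IH; rewrite size_cat size_map IH binS bin1 addnC.
Qed.

Local Notation bilinear_values phi ws :=
  (pairwise_values (fun u v => phi u v) ws).

(** * Isotropic subspaces and independent values of alternating maps *)

Section AlternatingMaps.
Variables (F : fieldType) (U B : vectType F).
Implicit Types (phi psi : 'Hom(U, 'Hom(U, B))) (K V W : {vspace U}).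
Implicit Types (ws : seq U).

Lemma alternating_swap phi u v :
  (forall w, phi w w = 0) -> phi u v = - phi v u.
Proof.
move=> alt; apply/eqP; rewrite -addr_eq0; apply/eqP.
have := alt (u + v).
by rewrite bilinearDl !linearD /= !alt add0r addr0 addrC.
Qed.

Lemma alternating_eq_on_span phi psi ws :
  (forall w, phi w w = 0) -> (forall w, psi w w = 0) ->
  bilinear_values phi ws = bilinear_values psi ws ->
  {in <<ws>>%VS &, forall u v, phi u v = psi u v}.
Proof.
move=> alt_phi alt_psi eq_ws.
have eq_mem : {in ws &, forall u v, phi u v = psi u v}.
  elim: ws eq_ws => //= x ws IH /eqP; rewrite eqseq_cat ?size_map //.
  case/andP=> /eqP/eq_in_map eq_x /eqP/IH eq_ws u v.
  rewrite !inE => /predU1P[->|uw] /predU1P[->|vw]; last exact: eq_ws.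
  - by rewrite alt_phi alt_psi.
  - rewrite alternating_swap // [RHS]alternating_swap //.
    by congr (- _); apply: eq_x.
  - exact: eq_x.
have eq_span u : u \in ws -> {in <<ws>>%VS, phi u =1 psi u}.
  move=> uw; apply/eqlfun_inP/span_subvP=> v vw.
  by apply/eqlfunP; apply: eq_mem.
move=> u v Wu Wv.
rewrite alternating_swap // [RHS]alternating_swap //; congr (- _).
move: u Wu; apply/eqlfun_inP/span_subvP=> u uw; apply/eqlfunP.
rewrite alternating_swap // [RHS]alternating_swap //; congr (- _).
exact: eq_span.
Qed.

Lemma isotropic_or_large_ranks phi r s K :
  (forall u, phi u u = 0) -> (0 < r)%N -> (s.+1 * r <= \dim K)%N ->
  (exists V, [/\ (V <= K)%VS, \dim V = s.+1
    & {in V &, forall u v, phi u v = 0}]) \/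
  (exists L, (r <= \dim L)%N /\
     forall w, w \in L -> w != 0 -> (\dim (L :&: lker (phi w)) + r <= \dim L)%N).
Proof.
move=> alt r_gt0; move: s.+1 => {}s; elim: s K => [|s IH] K dimK.
  left; exists 0%VS; split; rewrite ?sub0v ?dimv0 //.
  by move=> u v; rewrite !memv0 => /eqP-> /eqP->; rewrite linear0.
have [[w [Kw w0 dimw]]|noK] := classic (exists w,
    [/\ w \in K, w != 0 & (\dim K < \dim (K :&: lker (phi w)) + r)%N]); last first.
  right; exists K; split=> [|w Kw w0].
    by apply: leq_trans dimK; rewrite mulSn leq_addr.
  by rewrite leqNgt; apply/negP=> dimw; apply: noK; exists w.
pose L := (K :&: lker (phi w))%VS.
have Lw : w \in L by rewrite memv_cap Kw memv_ker alt /=.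
(* The complement of [w] in [L] has dimension at least [\dim K - r], so each new vector costs at
   most [r] dimensions. *)
have [|[V [VL dimV isoV]]|] := IH (L :\: <[w]>)%VS; last by right.
  by have := dimv_diff_line Lw w0; rewrite -/L in dimw *; lia.
left; exists (V + <[w]>)%VS; split.
- rewrite subv_add -memvE Kw andbT (subv_trans VL) //.
  by rewrite (subv_trans (diffvSl _ _)) ?capvSl.
- rewrite dimv_disjoint_sum ?dim_vline ?w0 ?dimV ?addn1 //.
  apply/eqP; rewrite -subv0 -(capv_diff L <[w]>); exact: capvS.
- have phiw v : v \in V -> phi w v = 0.
    move/(subvP VL)/(subvP (diffvSl _ _))/memv_capP=> [_].
    by rewrite memv_ker => /eqP.
  move=> x y /memv_addP[u Vu [cw /vlineP[c ->] ->]].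
  move=> /memv_addP[v Vv [dw /vlineP[d ->] ->]].
  rewrite bilinearDl bilinearZl !linearD /= !linearZ /=.
  rewrite isoV // phiw // alt alternating_swap // phiw // oppr0.
  by rewrite !scaler0 !addr0.
Qed.

(** The bound [2 * t ^ 2] covers, for every [k < t], the loss [\dim S <= k * k] together with the
    [1 + k * k.+2] that [separating_vector] asks for. *)
Lemma independent_pairwise_values phi K r t :
  (forall u, phi u u = 0) -> (2 * t ^ 2 <= r)%N -> (r <= \dim K)%N ->
  (forall w, w \in K -> w != 0 -> (\dim (K :&: lker (phi w)) + r <= \dim K)%N) ->
  exists ws, [/\ size ws = t, free ws & free (bilinear_values phi ws)].
Proof.
move=> alt ler dimK rankK.
have : (t <= t)%N by []; move: {-2}t.
suff H k : (k <= t)%N -> exists ws, [/\ size ws = k, free ws,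
    free (bilinear_values phi ws) & (<<ws>> <= K)%VS].
  by move=> k /H[ws [? ? ? _]]; exists ws.
elim: k => [_|k IH k_lt].
  by exists [::]; split; rewrite ?span_nil ?sub0v //= nil_free.
have [ws [size_ws free_ws free_phi Kws]] := IH (ltnW k_lt).
pose W := <<ws>>%VS; pose S := <<bilinear_values phi ws>>%VS.
have dimW : \dim W = k by rewrite -size_ws; apply/eqP.
have dimS : (\dim S <= k * k)%N.
  apply: leq_trans (dim_span _) _; rewrite size_pairwise_values size_ws bin2.
  by rewrite leq_half_double -?mul2n; nia.
have swap w v : phi w v = (- phi) v w.
  by rewrite opp_lfunE opp_lfunE -alternating_swap.
(* Avoiding [W] keeps the vectors free; injectivity modulo [S] keeps their values free. *)
have [|||x [Kx xW xS]] := separating_vector swap (K := K) (S := S)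
    (Hs := [:: W]) (r := 1 + k * k.+2) dimW _.
- by rewrite /=.
- move=> H; rewrite inE => /eqP->.
  have := dimvS (capvSr K W); rewrite dimW; nia.
- move=> w Ww w0; have := rankK w (subvP Kws w Ww) w0.
  have := dim_cap_preimD (phi w) K 0 S; rewrite add0v lpreim0; nia.
(* By alternation this is [phi w x] as a linear map in [w]. *)
pose fx := - phi x.
have fxE : [seq phi w x | w <- ws] = [seq fx w | w <- ws].
  by apply: eq_map => w; rewrite /fx opp_lfunE -alternating_swap.
have xS' w : w \in W -> fx w \in S -> w = 0.
  by rewrite /fx opp_lfunE -alternating_swap //; apply: xS.
exists (x :: ws); split.
- by rewrite /= size_ws.
- by rewrite free_cons free_ws xW ?mem_head.
- rewrite /= cat_free free_phi fxE /=; apply/andP; split.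
    rewrite /free -limg_span limg_dim_eq ?size_map //.
    apply/eqP; rewrite -subv0; apply/subvP=> w /memv_capP[Ww].
    by rewrite memv_ker => /eqP fw0; rewrite (xS' w) ?fw0 ?mem0v.
  apply/directv_addP/eqP; rewrite -subv0; apply/subvP=> y /memv_capP[].
  rewrite -limg_span => /memv_imgP[w Ww ->] /xS' ->; rewrite ?linear0 ?mem0v //.
- by rewrite span_cons subv_add -memvE Kx.
Qed.

End AlternatingMaps.

(** * The evaluation map into the dual of [A] *)

Section DualMap.
Variables (F : fieldType) (U : vectType F).
Variables (A : {vspace 'Hom(U, 'Hom(U, F^o))}).

(** Row vectors stand for the dual of [A], in the coordinates dual to [vbasis A]. *)
Definition dual_fun (u : U) : 'Hom(U, 'rV[F]_(\dim A)) :=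
  linfun (fun v => \row_(i < \dim A) ((vbasis A)`_i u v : F)).
Definition dual_map := linfun dual_fun.

Lemma dual_mapE u v : dual_map u v = \row_(i < \dim A) ((vbasis A)`_i u v : F).
Proof.
have funE w w' : dual_fun w w' = \row_(i < \dim A) ((vbasis A)`_i w w' : F).
  pose h w' := \row_(i < \dim A) ((vbasis A)`_i w w' : F).
  have lin_h : linear h.
    by move=> a x y; apply/rowP=> i; rewrite !mxE linearP.
  pose hL := GRing.isLinear.Build _ _ _ _ h lin_h.
  pose g : {linear U -> 'rV[F]_(\dim A)} := HB.pack h hL.
  exact: (lfunE g).
have lin_fun : linear dual_fun.
  move=> a x y; apply/lfunP=> w; rewrite add_lfunE scale_lfunE !funE.
  by apply/rowP=> i; rewrite !mxE linearP add_lfunE scale_lfunE.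
pose fL := GRing.isLinear.Build _ _ _ _ dual_fun lin_fun.
pose g : {linear U -> 'Hom(U, 'rV[F]_(\dim A))} := HB.pack dual_fun fL.
by rewrite /dual_map (lfunE g) funE.
Qed.

Lemma dual_map_eq0 u v : dual_map u v = 0 -> forall f, f \in A -> f u v = 0.
Proof.
rewrite dual_mapE => /rowP uv0 f /coord_vbasis ->.
rewrite sum_lfunE sum_lfunE big1 // => i _; rewrite !scale_lfunE.
by have := uv0 i; rewrite !mxE => ->; rewrite scaler0.
Qed.

(** This is reflexivity of [A]: the values of [l] on the unit rows are the coefficients of [f] in
    [vbasis A]. *)
Lemma dual_map_functional (l : {linear 'rV[F]_(\dim A) -> F^o}) :
  exists2 f, f \in A & forall u v, f u v = l (dual_map u v).
Proof.
exists (\sum_(i < \dim A) (l (delta_mx 0 i) : F) *: (vbasis A)`_i).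
  apply: memv_suml => i _; apply/memvZ/vbasis_mem/mem_nth.
  by rewrite size_tuple.
move=> u v; rewrite dual_mapE [X in l X]row_sum_delta linear_sum.
rewrite sum_lfunE sum_lfunE; apply: eq_bigr => i _.
rewrite !scale_lfunE mxE linearZ; exact: mulrC.
Qed.

End DualMap.

Theorem theorem1p1 (F : fieldType) (s t n : nat)
    (hs : (2 <= s)%N) (ht : (2 <= t)%N) (hn : (s * t ^ 4 <= n)%N)
    (U : vectType F) (hU : \dim (fullv : {vspace U}) = n)
    (A : {vspace 'Hom(U, 'Hom(U, F^o))})
    (hA : forall f, f \in A -> alternating f) :
  (exists V : {vspace U}, \dim V = s /\ (restr V @: A)%VS = 0%VS) \/
  (exists W : {vspace U}, \dim W = t /\
     forall g : 'Hom(subvs_of W, 'Hom(subvs_of W, F^o)),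
       g \in (restr W @: A)%VS <-> alternating g).
Proof.
pose phi := dual_map A.
have alt u : phi u u = 0.
  rewrite dual_mapE; apply/rowP=> i; rewrite !mxE; apply: hA.
  by apply/vbasis_mem/mem_nth; rewrite size_tuple.
case: s hs hn => // s _ hn.
have [||[V [_ dimV isoV]]|[K [dimK rankK]]] :=
  isotropic_or_large_ranks (phi := phi) (r := t ^ 4) (s := s) (K := fullv) alt.
- by rewrite expn_gt0; case: t ht {hn}.
- by rewrite hU.
- left; exists V; split=> //; apply/eqP; rewrite -subv0; apply/subvP.
  move=> _ /memv_imgP[f Af ->]; rewrite memv0; apply/eqP.
  apply/lfunP=> v; apply/lfunP=> w; rewrite restrE !zero_lfunE.
  by apply: dual_map_eq0 Af; apply: isoV; apply: subvsP.
right; have [|ws [size_ws free_ws free_phi]] :=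
    independent_pairwise_values (t := t) alt _ dimK rankK.
  (* [2 * t ^ 2 <= t ^ 4] holds because [t] is at least 2. *)
  by rewrite !expnS expn0; nia.
pose W := <<ws>>%VS; exists W; split; first by rewrite -size_ws; apply/eqP.
move=> g; split=> [/memv_imgP[f Af ->] u|alt_g]; first by rewrite restrE hA.
(* The same vectors in the type [subvs_of W], where [g] lives. *)
pose ws' := [seq vsproj W w | w <- ws].
have wsE : [seq vsval w | w <- ws'] = ws.
  rewrite -map_comp -[RHS]map_id; apply/eq_in_map=> w ww /=.
  by rewrite vsprojK ?memv_span.
have ws'_full u : u \in <<ws'>>%VS.
  have : linfun vsval u \in (linfun vsval @: <<ws'>>)%VS.
    rewrite limg_span (eq_map (lfunE _)) wsE lfunE; exact: subvsP.
  by case/memv_imgP=> v vW; rewrite !lfunE => /val_inj ->.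
(* As the values of [phi] are free, some functional [l] sends them to those of [g]; the form in [A]
   given by [l] then agrees with [g] on pairs from [ws'], hence on all of [W]. *)
have [l /(_ free_phi)] :=
  linear_of_free (rT := F^o) (bilinear_values phi ws) (bilinear_values g ws').
rewrite !size_pairwise_values size_map map_pairwise_values => /(_ erefl) lE.
have [f Af fE] := dual_map_functional l.
suff -> : g = restr W f by apply: memv_img.
apply/lfunP=> u; apply/lfunP=> v.
apply: (alternating_eq_on_span (ws := ws')) => //.
  by move=> w; rewrite restrE hA.
rewrite -lE -[in LHS]wsE; elim: ws' {wsE ws'_full lE} => //= w ws' ->.
congr (_ ++ _); rewrite -map_comp; apply: eq_map => w' /=.
by rewrite restrE fE.
Qed.
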